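(* Let $\Sigma$ be a set of unary function symbols and $\mathcal{K}$ a set of clauses each of the form $\forall x\, (f(x) \leq g(x))$ or $\forall x, y\, (y \leq g(x) \rightarrow f(y) \leq h(x))$ with $f, g, h \in \Sigma$ (not necessarily distinct). Then the theory $\mathsf{SLat} \cup \mathsf{Mon}_{\Sigma} \cup \mathcal{K}$ of semilattices with monotone operators satisfying $\mathcal{K}$ is $\leq$-interpolating with the notion of $\Theta_{\mathcal{K}}$-sharing for uninterpreted function symbols: for all conjunctions of ground atoms $A$ and $B$ in its signature (with additional constants) and every constant $a$ occurring in $A$ and $b$ occurring in $B$, if $A \wedge B \models_{\mathsf{SLat} \cup \mathsf{Mon}_{\Sigma} \cup \mathcal{K}} a \leq b$, then there is a ground term $t$ built using $\sqcap$, only constants occurring in both $A$ and $B$, and only function symbols in $\Theta_{\mathcal{K}}(\Sigma_A) \cap \Theta_{\mathcal{K}}(\Sigma_B)$, such that $A \wedge B \models_{\mathsf{SLat} \cup \mathsf{Mon}_{\Sigma} \cup \mathcal{K}} a \leq t \wedge t \leq b$.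
   Context: $\mathsf{SLat}$ is the theory of semilattices in the signature with a binary function $\sqcap$ and binary predicate $\leq$: $\sqcap$ is associative, commutative and idempotent, and $x \leq y$ iff $x \sqcap y \approx x$. $\mathsf{Mon}_{\Sigma} = \{ \forall x, y\,(x \leq y \rightarrow f(x) \leq f(y)) \mid f \in \Sigma\}$. The symbol $\sqcap$ is interpreted; the symbols of $\Sigma$ are uninterpreted. $\Sigma_A$, $\Sigma_B$ are the symbols of $\Sigma$ occurring in $A$, resp. $B$. For $f, g \in \Sigma$ let $f \sim_{\mathcal{K}} g$ iff $f$ and $g$ occur in a common clause of $\mathcal{K}$; $\sim^*_{\mathcal{K}}$ is the equivalence relation on $\Sigma$ generated by $\sim_{\mathcal{K}}$; $\Theta_{\mathcal{K}}(\Sigma') = \bigcup_{f \in \Sigma'} \{ g \in \Sigma \mid f \sim^*_{\mathcal{K}} g \}$. *)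

(* Defs.v *)
From Stdlib Require Import List Relations.
Import ListNotations.

Set Implicit Arguments.
Unset Strict Implicit.

(* Terms over the binary symbol ⊓, the unary symbols [Sig] and leaves [X].
   Ground terms are [term Sig C], with [C] the additional constants; the axioms,
   which contain no constants, use [term Sig nat], with leaves as variables. *)
Inductive term (Sig X : Type) : Type :=
| Leaf (x : X)
| Meet (s t : term Sig X)
| App (f : Sig) (t : term Sig X).

Arguments Leaf {Sig X} x.
Arguments Meet {Sig X} s t.
Arguments App {Sig X} f t.

Inductive atom (Sig X : Type) : Type :=
| Eq (s t : term Sig X)
| Le (s t : term Sig X).

Arguments Eq {Sig X} s t.
Arguments Le {Sig X} s t.

(* The universal closure of [/\ prems -> concl]. *)
Record clause (Sig : Type) : Type :=
  Clause { prems : list (atom Sig nat); concl : atom Sig nat }.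

Arguments Clause {Sig} prems concl.

Fixpoint leaf_in_term (Sig X : Type) (x : X) (t : term Sig X) : Prop :=
  match t with
  | Leaf y => x = y
  | Meet s u => leaf_in_term x s \/ leaf_in_term x u
  | App _ u => leaf_in_term x u
  end.

Fixpoint fun_in_term (Sig X : Type) (f : Sig) (t : term Sig X) : Prop :=
  match t with
  | Leaf _ => False
  | Meet s u => fun_in_term f s \/ fun_in_term f u
  | App g u => f = g \/ fun_in_term f u
  end.

Definition leaf_in_atom (Sig X : Type) (x : X) (p : atom Sig X) : Prop :=
  match p with Eq s t | Le s t => leaf_in_term x s \/ leaf_in_term x t end.

Definition fun_in_atom (Sig X : Type) (f : Sig) (p : atom Sig X) : Prop :=
  match p with Eq s t | Le s t => fun_in_term f s \/ fun_in_term f t end.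

(* Lists of ground atoms are read as conjunctions. *)
Definition const_in (Sig C : Type) (A : list (atom Sig C)) (c : C) : Prop :=
  Exists (leaf_in_atom c) A.

Definition fun_in (Sig C : Type) (A : list (atom Sig C)) (f : Sig) : Prop :=
  Exists (fun_in_atom f) A.

Definition fun_in_clause (Sig : Type) (f : Sig) (k : clause Sig) : Prop :=
  Exists (fun_in_atom f) (prems k) \/ fun_in_atom f (concl k).

Record structure (Sig : Type) : Type := Structure {
  dom :> Type;
  meet_of : dom -> dom -> dom;
  le_of : dom -> dom -> Prop;
  app_of : Sig -> dom -> dom
}.

Fixpoint eval (Sig X : Type) (M : structure Sig) (v : X -> M) (t : term Sig X)
    : M :=
  match t with
  | Leaf x => v x
  | Meet s u => meet_of (eval v s) (eval v u)
  | App f u => app_of f (eval v u)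
  end.

Definition holds (Sig X : Type) (M : structure Sig) (v : X -> M)
    (p : atom Sig X) : Prop :=
  match p with
  | Eq s t => eval v s = eval v t
  | Le s t => le_of (eval v s) (eval v t)
  end.

Definition satisfies (Sig : Type) (M : structure Sig) (k : clause Sig) : Prop :=
  forall v : nat -> M, Forall (holds v) (prems k) -> holds v (concl k).

Definition theory (Sig : Type) : Type := clause Sig -> Prop.

Definition model (Sig : Type) (T : theory Sig) (M : structure Sig) : Prop :=
  forall k, T k -> satisfies M k.

Definition entails (Sig C : Type) (T : theory Sig) (P Q : list (atom Sig C))
    : Prop :=
  forall M : structure Sig, model T M ->
  forall v : C -> M, Forall (holds v) P -> Forall (holds v) Q.

Definition theory_union (Sig : Type) (T U : theory Sig) : theory Sig :=
  fun k => T k \/ U k.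

Local Notation vx := (Leaf 0).
Local Notation vy := (Leaf 1).
Local Notation vz := (Leaf 2).

Inductive SLat (Sig : Type) : theory Sig :=
| SLat_assoc :
    SLat (Clause [] (Eq (Meet vx (Meet vy vz)) (Meet (Meet vx vy) vz)))
| SLat_comm : SLat (Clause [] (Eq (Meet vx vy) (Meet vy vx)))
| SLat_idem : SLat (Clause [] (Eq (Meet vx vx) vx))
| SLat_le_meet : SLat (Clause [Le vx vy] (Eq (Meet vx vy) vx))
| SLat_meet_le : SLat (Clause [Eq (Meet vx vy) vx] (Le vx vy)).

Arguments SLat Sig _ : clear implicits.

Inductive Mon (Sig : Type) : theory Sig :=
| Mon_intro (f : Sig) : Mon (Clause [Le vx vy] (Le (App f vx) (App f vy))).

Arguments Mon Sig _ : clear implicits.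

(* forall x, f(x) <= g(x) *)
Definition incl_clause (Sig : Type) (f g : Sig) : clause Sig :=
  Clause [] (Le (App f vx) (App g vx)).

(* forall x y, y <= g(x) -> f(y) <= h(x) *)
Definition comp_clause (Sig : Type) (f g h : Sig) : clause Sig :=
  Clause [Le vy (App g vx)] (Le (App f vy) (App h vx)).

Definition common_clause (Sig : Type) (K : theory Sig) : relation Sig :=
  fun f g => exists k, K k /\ fun_in_clause f k /\ fun_in_clause g k.

Definition Theta (Sig : Type) (K : theory Sig) (S : Sig -> Prop)
    : Sig -> Prop :=
  fun g => exists f, S f /\ clos_refl_sym_trans Sig (common_clause K) f g.

(* Main.v *)
Require Import Defs.
From Stdlib Require Import List Relations.
From Stdlib Require Import FunctionalExtensionality PropExtensionality.
Import ListNotations.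

(** Write [s ⊑ t] when [A /\ B] entails [s <= t]. Take two copies of the ground
    terms, one for [A] and one for [B], keep [⊑] inside each copy, and put
    [s] below [t] across the copies only when [s ⊑ m ⊑ t] for some term [m] in the
    shared signature. Shared terms are closed under meet and under the shared
    functions, so meets computed in a copy remain greatest lower bounds and the
    shared functions remain monotone across the copies.

    Hence the powerset of this preorder is a model of the theory: meet is
    intersection, and [f] sends [D] to the downward closure of all [f s] with [s]
    in [D] lying in a copy whose signature contains [f]. A clause of [K] relates
    only symbols defined on the same copies, so it holds there. Terms in the
    signature of a copy evaluate to their principal downsets, so [A] and [B] hold;
    [a <= b] in this model is exactly the existence of an interpolant. *)

Section SemilatticesWithOperators.

Variables (Sig : Type) (K : theory Sig).

Let T : theory Sig := theory_union (theory_union (SLat Sig) (Mon Sig)) K.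

(** * The axioms instantiated in an arbitrary model *)

Lemma le_of_meet (M : structure Sig) (x y : M) :
  model T M -> le_of x y <-> meet_of x y = x.
Proof.
  intros HM.
  set (v := fun n => match n with 0 => x | _ => y end).
  split; intros H.
  - refine (HM _ (or_introl (or_introl (SLat_le_meet Sig))) v _).
    now repeat constructor.
  - refine (HM _ (or_introl (or_introl (SLat_meet_le Sig))) v _).
    now repeat constructor.
Qed.

Lemma meet_of_comm (M : structure Sig) (x y : M) :
  model T M -> meet_of x y = meet_of y x.
Proof.
  intros HM.
  set (v := fun n => match n with 0 => x | _ => y end).
  exact (HM _ (or_introl (or_introl (SLat_comm Sig))) v (Forall_nil _)).
Qed.

Lemma meet_of_idem (M : structure Sig) (x : M) :
  model T M -> meet_of x x = x.
Proof.
  intros HM.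
  exact (HM _ (or_introl (or_introl (SLat_idem Sig))) (fun _ => x)
           (Forall_nil _)).
Qed.

Lemma meet_of_assoc (M : structure Sig) (x y z : M) :
  model T M -> meet_of x (meet_of y z) = meet_of (meet_of x y) z.
Proof.
  intros HM.
  set (v := fun n => match n with 0 => x | 1 => y | _ => z end).
  exact (HM _ (or_introl (or_introl (SLat_assoc Sig))) v (Forall_nil _)).
Qed.

Lemma le_of_app (M : structure Sig) (f : Sig) (x y : M) :
  model T M -> le_of x y -> le_of (app_of f x) (app_of f y).
Proof.
  intros HM H.
  set (v := fun n => match n with 0 => x | _ => y end).
  refine (HM _ (or_introl (or_intror (Mon_intro f))) v _).
  now repeat constructor.
Qed.

Lemma le_of_incl (M : structure Sig) (f g : Sig) (x : M) :
  K (incl_clause f g) -> model T M -> le_of (app_of f x) (app_of g x).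
Proof.
  intros Hk HM.
  exact (HM _ (or_intror Hk) (fun _ => x) (Forall_nil _)).
Qed.

Lemma le_of_comp (M : structure Sig) (f g h : Sig) (x y : M) :
  K (comp_clause f g h) -> model T M ->
  le_of y (app_of g x) -> le_of (app_of f y) (app_of h x).
Proof.
  intros Hk HM H.
  set (v := fun n => match n with 0 => x | _ => y end).
  refine (HM _ (or_intror Hk) v _).
  now repeat constructor.
Qed.

(** This makes all symbols of a clause of [K] available on the same sides, so that the clause can be
    checked one copy at a time. *)
Lemma Theta_common_clause (S : Sig -> Prop) (f g : Sig) :
  common_clause K f g -> Theta K S f -> Theta K S g.
Proof.
  intros Hfg (e & He & Hef).
  exists e; split; [exact He|].
  eapply rst_trans; [exact Hef | now apply rst_step].
Qed.

Variables (C : Type) (A B : list (atom Sig C)).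

(** * The entailment preorder on ground terms *)

Definition entails_le (s t : term Sig C) : Prop :=
  entails T (A ++ B) [Le s t].

Local Infix "⊑" := entails_le (at level 70).

Lemma entails_leP (s t : term Sig C) :
  s ⊑ t <->
  (forall M : structure Sig, model T M -> forall v : C -> M,
     Forall (holds v) (A ++ B) -> le_of (eval v s) (eval v t)).
Proof.
  split; intros H M HM v Hv.
  - exact (Forall_inv (H M HM v Hv)).
  - constructor; [now apply H | constructor].
Qed.

Lemma entails_le_refl (s : term Sig C) : s ⊑ s.
Proof.
  apply entails_leP; intros M HM v _.
  now apply le_of_meet, meet_of_idem.
Qed.

Lemma entails_le_trans (s t u : term Sig C) : s ⊑ t -> t ⊑ u -> s ⊑ u.
Proof.
  rewrite !entails_leP; intros Hst Htu M HM v Hv.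
  specialize (Hst M HM v Hv); specialize (Htu M HM v Hv).
  rewrite le_of_meet in * by assumption.
  now rewrite <- Hst, <- meet_of_assoc, Htu.
Qed.

Lemma entails_le_meetl (s t : term Sig C) : Meet s t ⊑ s.
Proof.
  apply entails_leP; intros M HM v _; simpl.
  rewrite le_of_meet by assumption.
  now rewrite meet_of_comm, meet_of_assoc, meet_of_idem.
Qed.

Lemma entails_le_meetr (s t : term Sig C) : Meet s t ⊑ t.
Proof.
  apply entails_leP; intros M HM v _; simpl.
  rewrite le_of_meet by assumption.
  now rewrite <- meet_of_assoc, meet_of_idem.
Qed.

Lemma entails_le_meet (s t u : term Sig C) : s ⊑ t -> s ⊑ u -> s ⊑ Meet t u.
Proof.
  rewrite !entails_leP; intros Hst Hsu M HM v Hv; simpl.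
  specialize (Hst M HM v Hv); specialize (Hsu M HM v Hv).
  rewrite le_of_meet in * by assumption.
  now rewrite meet_of_assoc, Hst, Hsu.
Qed.

Lemma entails_le_app (f : Sig) (s t : term Sig C) :
  s ⊑ t -> App f s ⊑ App f t.
Proof.
  rewrite !entails_leP; intros Hst M HM v Hv.
  now apply le_of_app; [|apply Hst].
Qed.

Lemma entails_le_incl (f g : Sig) (s : term Sig C) :
  K (incl_clause f g) -> App f s ⊑ App g s.
Proof.
  intros Hk; apply entails_leP; intros M HM v _.
  now apply le_of_incl.
Qed.

Lemma entails_le_comp (f g h : Sig) (s t : term Sig C) :
  K (comp_clause f g h) -> t ⊑ App g s -> App f t ⊑ App h s.
Proof.
  rewrite !entails_leP; intros Hk Hts M HM v Hv.
  apply (le_of_comp _ _ g); [assumption..|].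
  exact (Hts M HM v Hv).
Qed.

(** * The signatures of the two sides *)

Definition side (i : bool) : list (atom Sig C) := if i then A else B.

Lemma side_entails_le (i : bool) (p : atom Sig C) :
  In p (side i) ->
  match p with Eq s t => s ⊑ t /\ t ⊑ s | Le s t => s ⊑ t end.
Proof.
  intros Hp.
  assert (HAB : In p (A ++ B)) by (apply in_app_iff; destruct i; auto).
  assert (H : forall (M : structure Sig) (v : C -> M),
             Forall (holds v) (A ++ B) -> holds v p)
    by (intros M v Hv; rewrite Forall_forall in Hv; auto).
  destruct p as [s t|s t]; [split|]; apply entails_leP; intros M HM v Hv;
    specialize (H M v Hv); simpl in H.
  - rewrite H. now apply le_of_meet, meet_of_idem.
  - rewrite H. now apply le_of_meet, meet_of_idem.
  - exact H.
Qed.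

Definition in_side (i : bool) (t : term Sig C) : Prop :=
  (forall c, leaf_in_term c t -> const_in (side i) c) /\
  (forall f, fun_in_term f t -> Theta K (fun_in (side i)) f).

Lemma in_side_meet (i : bool) (s t : term Sig C) :
  in_side i (Meet s t) <-> in_side i s /\ in_side i t.
Proof.
  unfold in_side; simpl; firstorder.
Qed.

Lemma in_side_app (i : bool) (f : Sig) (t : term Sig C) :
  in_side i (App f t) <-> Theta K (fun_in (side i)) f /\ in_side i t.
Proof.
  unfold in_side; simpl; split.
  - intros [Hc Hf]; auto 6.
  - intros [Hf [Hc Ht]]; split; [exact Hc|].
    intros g [->|Hg]; auto.
Qed.

Lemma in_side_atom (i : bool) (p : atom Sig C) :
  In p (side i) ->
  match p with Eq s t | Le s t => in_side i s /\ in_side i t end.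
Proof.
  intros Hp.
  assert (Hc : forall c, leaf_in_atom c p -> const_in (side i) c)
    by (intros c Hc; apply Exists_exists; eauto).
  assert (Hf : forall f, fun_in_atom f p -> Theta K (fun_in (side i)) f).
  { intros f Hf; exists f; split; [|apply rst_refl].
    apply Exists_exists; eauto. }
  destruct p; unfold in_side; simpl in *; auto 8.
Qed.

Definition shared (m : term Sig C) : Prop := forall i, in_side i m.

(** * The preorder on two copies of the terms *)

(** Each copy holds all ground terms; signatures enter only through [shared] and through the side
    condition on operators in [powerset]. *)
Definition copies : Type := (bool * term Sig C)%type.

Definition copies_le (x y : copies) : Prop :=
  (fst x = fst y /\ snd x ⊑ snd y) \/
  (exists m, shared m /\ snd x ⊑ m /\ m ⊑ snd y).

Lemma copies_le_refl (x : copies) : copies_le x x.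
Proof. left; split; [reflexivity | apply entails_le_refl]. Qed.

Lemma copies_le_trans (x y z : copies) :
  copies_le x y -> copies_le y z -> copies_le x z.
Proof.
  unfold copies_le.
  intros [[Exy Hxy]|(m & Hm & Hxm & Hmy)] [[Eyz Hyz]|(n & Hn & Hyn & Hnz)].
  - left; split; [congruence | now apply entails_le_trans with (snd y)].
  - right; exists n; repeat split; trivial; try apply Hn.
    now apply entails_le_trans with (snd y).
  - right; exists m; repeat split; trivial; try apply Hm.
    now apply entails_le_trans with (snd y).
  - right; exists m; repeat split; trivial; try apply Hm.
    apply entails_le_trans with (snd y); trivial.
    now apply entails_le_trans with n.
Qed.

Lemma copies_le_same (i : bool) (s t : term Sig C) :
  copies_le (i, s) (i, t) <-> s ⊑ t.
Proof.
  split.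
  - intros [[_ H]|(m & _ & H1 & H2)]; [exact H|].
    exact (entails_le_trans _ _ _ H1 H2).
  - intros H; left; auto.
Qed.

(** Across the copies, interpolants [m] for [s] and [n] for [t] combine into the shared term
    [Meet m n]. If either comparison stays inside a copy, then [z] lies in copy [i] and both reduce
    to [⊑]. *)
Lemma copies_le_meet (z : copies) (i : bool) (s t : term Sig C) :
  copies_le z (i, Meet s t) <-> copies_le z (i, s) /\ copies_le z (i, t).
Proof.
  split.
  - intros H; split; (eapply copies_le_trans; [exact H|]);
      apply copies_le_same; [apply entails_le_meetl | apply entails_le_meetr].
  - assert (Hsame : fst z = i -> copies_le z (i, s) -> copies_le z (i, t) ->
                    copies_le z (i, Meet s t)).
    { destruct z as [j u]; simpl; intros ->; rewrite !copies_le_same.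
      apply entails_le_meet. }
    intros [Hs Ht].
    pose proof Hs as Hs'; pose proof Ht as Ht'.
    destruct Hs' as [[E _]|(m & Hm & Hzm & Hms)]; [now apply Hsame|].
    destruct Ht' as [[E _]|(n & Hn & Hzn & Hnt)]; [now apply Hsame|].
    right; exists (Meet m n); split; [|split].
    + intros j; apply in_side_meet; auto.
    + now apply entails_le_meet.
    + apply entails_le_meet; eapply entails_le_trans; eauto;
        [apply entails_le_meetl | apply entails_le_meetr].
Qed.

Lemma shared_app (f : Sig) (i j : bool) (m : term Sig C) :
  i <> j -> Theta K (fun_in (side i)) f -> Theta K (fun_in (side j)) f ->
  shared m -> shared (App f m).
Proof.
  intros Hij Hi Hj Hm k; apply in_side_app; split; [|apply Hm].
  destruct i, j, k; tauto.
Qed.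

(** An interpolant [m] between [s] and [u] yields the interpolant [App f m], which is shared because
    [f] is available on both sides. The first premise covers monotonicity ([h = f], [u = t]) as well
    as a clause [comp_clause f g h] ([u = App g t]). *)
Lemma copies_le_app (f h : Sig) (i j : bool) (s u t : term Sig C) :
  (forall r, r ⊑ u -> App f r ⊑ App h t) ->
  Theta K (fun_in (side i)) f -> Theta K (fun_in (side j)) f ->
  copies_le (j, s) (i, u) -> copies_le (j, App f s) (i, App h t).
Proof.
  intros Hfh Hi Hj H.
  destruct (Bool.bool_dec i j) as [<-|Hij].
  - rewrite copies_le_same in *; auto.
  - destruct H as [[E _]|(m & Hm & Hsm & Hmu)]; [now symmetry in E|].
    right; exists (App f m); split; [|split]; simpl.
    + now apply shared_app with i j.
    + now apply entails_le_app.
    + now apply Hfh.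
Qed.

(** * The powerset model *)

Definition powerset : structure Sig :=
  Structure (dom := copies -> Prop)
    (fun D E z => D z /\ E z)
    (fun D E => forall z, D z -> E z)
    (fun f D z => exists i s,
       D (i, s) /\ Theta K (fun_in (side i)) f /\ copies_le z (i, App f s)).

Lemma powerset_ext (D E : powerset) : (forall z, D z <-> E z) -> D = E.
Proof.
  intros H; apply functional_extensionality; intros z.
  now apply propositional_extensionality.
Qed.

Hypothesis HK : forall k, K k ->
  (exists f g : Sig, k = incl_clause f g) \/
  (exists f g h : Sig, k = comp_clause f g h).

Lemma powerset_model : model T powerset.
Proof.
  intros k [[Hk|Hk]|Hk] v Hv.
  - destruct Hk; simpl in *; try (apply powerset_ext; simpl; tauto).
    + apply Forall_inv in Hv; simpl in Hv.
      apply powerset_ext; simpl; firstorder.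
    + apply Forall_inv in Hv; simpl in Hv.
      intros z Hz; rewrite <- Hv in Hz; apply Hz.
  - destruct Hk; simpl in *.
    apply Forall_inv in Hv; simpl in Hv.
    intros z (i & s & Hs & Hf & Hz); exists i, s; auto.
  - destruct (HK _ Hk) as [(f & g & ->)|(f & g & h & ->)]; simpl in *.
    + intros z (i & s & Hs & Hf & Hz); exists i, s; split; [exact Hs|split].
      * refine (Theta_common_clause _ f g _ Hf).
        exists (incl_clause f g).
        unfold fun_in_clause; simpl; auto 6.
      * eapply copies_le_trans; [exact Hz|].
        now apply copies_le_same, entails_le_incl.
    + apply Forall_inv in Hv; simpl in Hv.
      assert (Hin : forall e, e = f \/ e = g \/ e = h ->
                fun_in_clause e (comp_clause f g h)).
      { unfold fun_in_clause; simpl; intros e He.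
        destruct He as [He|[He|He]]; [right|left; constructor|right]; simpl;
          auto. }
      assert (Hcc : forall e, e = f \/ e = h -> common_clause K g e)
        by (intros e He; exists (comp_clause f g h); intuition).
      intros z (j & s & Hs & Hf & Hz).
      (* The premise places [(j, s)] below [App g t] in a possibly different copy [i]. Since [g] is
         available on side [i], so are [f] and [h]; [f] is also available on side [j], as crossing
         the copies requires. *)
      destruct (Hv _ Hs) as (i & t & Ht & Hg & Hst).
      exists i, t; split; [exact Ht|split].
      * refine (Theta_common_clause _ g h _ Hg); auto.
      * eapply copies_le_trans; [exact Hz|].
        apply copies_le_app with (u := App g t); trivial.
        -- intros r; now apply entails_le_comp.
        -- refine (Theta_common_clause _ g f _ Hg); auto.
Qed.

(** A constant occurring on both sides must have one value, hence the union over the sides where it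
    occurs. *)
Definition principal (c : C) : powerset :=
  fun z => exists i, const_in (side i) c /\ copies_le z (i, Leaf c).

(** By induction on [t]. The value also collects elements contributed by the other copy; these are
    already below [(i, t)], because a constant or function symbol available on both sides lets the
    comparison cross. *)
Lemma eval_principal (i : bool) (t : term Sig C) :
  in_side i t -> forall z, eval principal t z <-> copies_le z (i, t).
Proof.
  induction t as [c|s IHs t IHt|f t IHt]; intros Hi z; simpl.
  - pose proof (proj1 Hi c eq_refl) as Hci; split; [|now exists i].
    intros (j & Hcj & Hz).
    eapply copies_le_trans; [exact Hz|].
    destruct (Bool.bool_dec i j) as [<-|Hij]; [apply copies_le_refl|].
    (* Here [c] occurs on both sides, so it is its own interpolant. *)
    right; exists (Leaf c); split; [|split; apply entails_le_refl].
    intros k; split; simpl; [|tauto].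
    intros c' ->; destruct i, j, k; tauto.
  - apply in_side_meet in Hi as [Hs Ht].
    now rewrite copies_le_meet, IHs, IHt.
  - apply in_side_app in Hi as [Hf Ht]; split.
    + intros (j & s & Hs & Hfj & Hz).
      eapply copies_le_trans; [exact Hz|].
      apply copies_le_app with (u := t); trivial.
      * intros r; apply entails_le_app.
      * now apply (IHt Ht).
    + intros Hz; exists i, t; split; [|now split].
      apply (IHt Ht), copies_le_refl.
Qed.

Lemma principal_holds : Forall (holds principal) (A ++ B).
Proof.
  assert (H : forall i p, In p (side i) -> holds principal p).
  { intros i p Hp.
    pose proof (in_side_atom i p Hp) as Hi.
    pose proof (side_entails_le i p Hp) as Hle.
    destruct p as [s t|s t]; destruct Hi as [Hs Ht]; simpl.
    - apply powerset_ext; intros z.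
      rewrite (eval_principal i s Hs), (eval_principal i t Ht).
      split; intros Hz; (eapply copies_le_trans; [exact Hz|]);
        now apply copies_le_same.
    - intros z.
      rewrite (eval_principal i s Hs), (eval_principal i t Ht); intros Hz.
      eapply copies_le_trans; [exact Hz|]; now apply copies_le_same. }
  apply Forall_forall; intros p Hp.
  apply in_app_iff in Hp as [Hp|Hp]; [now apply (H true)|now apply (H false)].
Qed.

(** * Extraction of the interpolant *)

Lemma entails_le_interpolant (s t : term Sig C) :
  in_side true s -> in_side false t -> s ⊑ t ->
  exists m, shared m /\ s ⊑ m /\ m ⊑ t.
Proof.
  intros Hs Ht Hst.
  rewrite entails_leP in Hst.
  (* The point [(true, s)] lies in the value of [s], hence in that of [t], the downset of
     [(false, t)]. The copies differ, so only the disjunct with a shared term can hold. *)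
  specialize (Hst _ powerset_model _ principal_holds (true, s)).
  rewrite (eval_principal true s Hs), (eval_principal false t Ht) in Hst.
  destruct (Hst (copies_le_refl _)) as [[E _]|H]; [discriminate E|exact H].
Qed.

End SemilatticesWithOperators.

Theorem theorem11 (Sig C : Type) (K : theory Sig)
  (HK : forall k, K k ->
     (exists f g : Sig, k = incl_clause f g) \/
     (exists f g h : Sig, k = comp_clause f g h))
  (A B : list (atom Sig C)) (a b : C)
  (Ha : const_in A a) (Hb : const_in B b)
  (Hab : entails (theory_union (theory_union (SLat Sig) (Mon Sig)) K) (A ++ B)
           [Le (Leaf a) (Leaf b)]) :
  exists t : term Sig C,
    (forall c : C, leaf_in_term c t -> const_in A c /\ const_in B c) /\
    (forall f : Sig, fun_in_term f t ->
       Theta K (fun_in A) f /\ Theta K (fun_in B) f) /\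
    entails (theory_union (theory_union (SLat Sig) (Mon Sig)) K) (A ++ B)
      [Le (Leaf a) t; Le t (Leaf b)].
Proof.
  destruct (entails_le_interpolant Sig K C A B HK (Leaf a) (Leaf b))
    as (m & Hm & Ham & Hmb).
  - split; simpl; [now intros c ->|tauto].
  - split; simpl; [now intros c ->|tauto].
  - exact Hab.
  - destruct (Hm true) as [HcA HfA], (Hm false) as [HcB HfB].
    exists m; split; [|split]; auto.
    intros M HM v Hv.
    constructor; [exact (Forall_inv (Ham M HM v Hv)) | exact (Hmb M HM v Hv)].
Qed.
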